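(* For a Dyck path $P$ let $\operatorname{val}(P)$ and $\operatorname{dr}(P)$ denote, respectively, the number of valleys (occurrences of $DU$ as a factor of two consecutive letters) and the number of double rises (occurrences of $UU$ as a factor of two consecutive letters) of $P$. There exists a map $H\in\mathsf{sRR}_1\subseteq\mathsf{WRP}$, namely the height-sweep map $H\colon\{U,D\}^*\to\{U,D\}^*$, such that for every $n\ge 0$ the restriction of $H$ to $\mathcal D_n$ is a bijection from $\mathcal D_n$ onto $\mathcal D_n$ satisfying $$\operatorname{dr}(H(P))=\operatorname{val}(P)\quad\text{and}\quad \operatorname{val}(H(P))=\operatorname{dr}(P)\qquad\text{for every }P\in\mathcal D_n.$$ Consequently, $H$ realises the bivariate Narayana symmetry: for every $n$, $$\sum_{P\in\mathcal D_n}q^{\operatorname{val}(P)}t^{\operatorname{dr}(P)}=\sum_{P\in\mathcal D_n}q^{\operatorname{dr}(P)}t^{\operatorname{val}(P)}.$$ Furthermore, no polyregular map agrees with $H$ on every Dyck path: there is no polyregular map $T\colon\{U,D\}^*\rightharpoonup\{U,D\}^*$ with $\mathcal D\subseteq\operatorname{dom}(T)$ and $T(P)=H(P)$ for all $P\in\mathcal D$.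
   Context: **Dyck paths.** A Dyck path of semilength $n$ is a word $P\in\{U,D\}^{2n}$ with $n$ letters $U$ and $n$ letters $D$ such that every prefix has at least as many $U$'s as $D$'s. $\mathcal D_n$ is the set of these, $\mathcal D=\bigcup_{n\ge0}\mathcal D_n$. For a word $w\in\{U,D\}^*$, $h_w(k)$ is the number of $U$'s minus the number of $D$'s among its first $k$ letters. **Height-sweep map.** The starting height of the step (letter) at position $i$ of $w$ is $h_w(i-1)$. $H(w)$ is the word obtained by listing the letters of $w$ by increasing starting height, ties between letters of equal starting height being broken by decreasing input position (right to left). **MSO on words.** A word $w=a_1\cdots a_n$ over a finite alphabet $\Sigma$ is a structure with universe $\mathrm{Pos}(w)=\{1,\dots,n\}$, the order $<$, and unary predicates $P_a$ ($a\in\Sigma$) with $P_a(i)$ iff $a_i=a$. MSO formulas are built from $x<y$, $x=y$, $P_a(x)$, $x\in X$ by Boolean connectives and quantification over positions and over sets of positions. $w\models\varphi(i_1,\dots,i_k)$ denotes satisfaction. **Polyregular maps.** A polyregular presentation (input alphabet $\Sigma$, output alphabet $\Gamma$, both finite) consists of: a nonempty finite set $C$ of copy names, each $c\in C$ with an arity $k_c\ge1$; an MSO domain sentence $\varphi_{\mathrm{dom}}$; for each $c$ an MSO selection formula $\varphi_c(x_1,\dots,x_{k_c})$, giving the set of selected atoms $\mathrm{At}(w)=\{(c,\bar i):c\in C,\ \bar i\in\mathrm{Pos}(w)^{k_c},\ w\models\varphi_c(\bar i)\}$; for each $c$ and $\gamma\in\Gamma$ an MSO label formula $\psi_{c,\gamma}(x_1,\dots,x_{k_c})$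 such that each selected atom $(c,\bar i)$ satisfies exactly one of them, that $\gamma$ being its label; and for each pair $c,c'\in C$ an MSO ordering formula $\chi_{c,c'}(\bar x,\bar y)$, such that on each $w$ these define a strict linear order $\chi$ on $\mathrm{At}(w)$. It determines the partial map $f\colon\Sigma^*\rightharpoonup\Gamma^*$ with domain $\{w:w\models\varphi_{\mathrm{dom}}\}$ whose value $f(w)$ is the concatenation of the labels of the selected atoms listed in increasing $\chi$-order. A partial map is polyregular if it is determined by some such presentation. **Rank functions.** A $d$-dimensional deterministic additive rank source over $\Sigma$ is $A=(Q,q_0,\delta,\omega)$ with $Q$ a finite set, $q_0\in Q$, $\delta\colon Q\times\Sigma\to Q$, $\omega\colon Q\times\Sigma\to\mathbb Z^d$. On $w=a_1\cdots a_n$ put $q_i=\delta(q_{i-1},a_i)$; for $1\le i\le n+1$ the prefix rank is $\rho_A^w(i)=\sum_{j<i}\omega(q_{j-1},a_j)$, and $q^A_i:=q_{i-1}$ is the state just before position $i$. A $d$-dimensional prefix-additive rank function on $k$-tuples of positions is a function of the form $\kappa^w(x_1,\dots,x_k)=c_0+\sum_{r=1}^k\bigl(\rho_{A_r}^w(x_r)+\beta_r(q^{A_r}_{x_r},a_{x_r})\bigr)$, with $c_0\in\mathbb Z^d$ fixed, $A_r$ fixed $d$-dimensional rank sources with state sets $Q_r$, and $\beta_r\colon Q_r\times\Sigma\to\mathbb Z^d$ fixed tables. **WRP and $\mathsf{sRR}_1$.** A $\mathsf{WRP}$ presentation is a polyregular presentation together with a fixed $d\ge0$ and, for each $c\in C$,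 a $d$-dimensional prefix-additive rank function $\kappa_c$ on $k_c$-tuples. Selected atoms are ordered by $(c,\bar i)\prec(c',\bar i')$ iff $\kappa_c^w(\bar i)<_{\mathrm{lex}}\kappa_{c'}^w(\bar i')$, or these vectors are equal and $(c,\bar i)$ precedes $(c',\bar i')$ in the tie-order $\chi$. The associated map has domain $\{w:w\models\varphi_{\mathrm{dom}}\}$ and value the concatenation of the labels of the selected atoms in increasing $\prec$-order. $\mathsf{WRP}$ is the class of partial maps so obtained. $\mathsf{sRR}_1$ is the class of maps having a $\mathsf{WRP}$ presentation in which all copy names have arity $1$, $d=1$, and $\chi$ is a scan order, i.e. is given by a direction on positions (left-to-right or right-to-left) and a linear order on $C$: position order in that direction decides first, and the order on $C$ breaks ties between atoms at the same position. *)

(* Defs.v *)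
From HB Require Import structures.
From mathcomp Require Import all_boot all_order all_algebra.

Set Implicit Arguments.
Unset Strict Implicit.
Unset Printing Implicit Defensive.

Import Order.TTheory GRing.Theory Num.Theory.
Local Open Scope ring_scope.

(** * Words over {U, D} and Dyck paths *)

Inductive step : predArgType := U | D.

Definition bool_of_step (s : step) : bool := if s is U then true else false.
Definition step_of_bool (b : bool) : step := if b then U else D.
Lemma bool_of_stepK : cancel bool_of_step step_of_bool.
Proof. by case. Qed.
HB.instance Definition _ := Finite.copy step (can_type bool_of_stepK).

Definition height (w : seq step) (k : nat) : int :=
  (count_mem U (take k w))%:Z - (count_mem D (take k w))%:Z.

Definition dyck (n : nat) : pred (seq step) := fun w =>
  [&& size w == n.*2, count_mem U w == n, count_mem D w == n &
      all (fun k => 0 <= height w k) (iota 0 (size w).+1)].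

(* The occurrences of the two-letter factor ab. *)
Definition factor_count (a b : step) (w : seq step) : nat :=
  count_mem (a, b) (zip w (behead w)).

Definition valleys : seq step -> nat := factor_count D U.
Definition double_rises : seq step -> nat := factor_count U U.

(* Positions are 0-based throughout, so the step at position i starts at
   height [height w i]. *)
Definition height_sweep (w : seq step) : seq step :=
  [seq tnth (in_tuple w) i |
     i <- sort (fun i j : 'I_(size w) =>
                  (height w i < height w j)
                  || (height w i == height w j) && (j <= i)%N)
               (enum 'I_(size w))].

(** * MSO on words *)

(* Formulas with k free position variables and m free set variables, in de
   Bruijn style: a quantifier binds variable 0 of the appropriate sort.
   Scoping by types keeps the semantics meaningful on the empty word, where
   only closed formulas can be evaluated. *)
Inductive mso (Sigma : Type) : nat -> nat -> Type :=
| MLt k m : 'I_k -> 'I_k -> mso Sigma k m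
| MEq k m : 'I_k -> 'I_k -> mso Sigma k m
| MLetter k m : Sigma -> 'I_k -> mso Sigma k m
| MIn k m : 'I_k -> 'I_m -> mso Sigma k m
| MNot k m : mso Sigma k m -> mso Sigma k m
| MAnd k m : mso Sigma k m -> mso Sigma k m -> mso Sigma k m
| MOr k m : mso Sigma k m -> mso Sigma k m -> mso Sigma k m
| MExPos k m : mso Sigma k.+1 m -> mso Sigma k m
| MAllPos k m : mso Sigma k.+1 m -> mso Sigma k m
| MExSet k m : mso Sigma k m.+1 -> mso Sigma k m
| MAllSet k m : mso Sigma k m.+1 -> mso Sigma k m.

Fixpoint msat (Sigma : eqType) (w : seq Sigma) (k m : nat)
    (phi : mso Sigma k m) :
    k.-tuple 'I_(size w) -> m.-tuple {set 'I_(size w)} -> bool :=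
  match phi in mso _ k m return
    k.-tuple 'I_(size w) -> m.-tuple {set 'I_(size w)} -> bool with
  | MLt _ _ x y => fun e _ => (tnth e x < tnth e y)%N
  | MEq _ _ x y => fun e _ => tnth e x == tnth e y
  | MLetter _ _ a x => fun e _ => tnth (in_tuple w) (tnth e x) == a
  | MIn _ _ x X => fun e E => tnth e x \in tnth E X
  | MNot _ _ p => fun e E => ~~ msat p e E
  | MAnd _ _ p q => fun e E => msat p e E && msat q e E
  | MOr _ _ p q => fun e E => msat p e E || msat q e E
  | MExPos _ _ p => fun e E => [exists i, msat p [tuple of i :: e] E]
  | MAllPos _ _ p => fun e E => [forall i, msat p [tuple of i :: e] E]
  | MExSet _ _ p => fun e E => [exists A, msat p e [tuple of A :: E]]
  | MAllSet _ _ p => fun e E => [forall A, msat p e [tuple of A :: E]]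
  end.

Arguments msat {Sigma} w {k m} phi _ _.

(* Formulas whose free variables are k position variables. *)
Definition models (Sigma : eqType) (w : seq Sigma) (k : nat)
  (phi : mso Sigma k 0) (x : k.-tuple 'I_(size w)) : bool :=
  msat w phi x [tuple].

Arguments models {Sigma} w {k} phi x.

(** * Polyregular maps *)

Definition partial_map (Sigma Gamma : Type) := seq Sigma -> option (seq Gamma).

Definition strict_linear_on (T : eqType) (A : {pred T}) (r : rel T) : Prop :=
  [/\ {in A, irreflexive r}, {in A & &, transitive r} &
      {in A &, forall x y, x != y -> r x y || r y x}].

Record presentation_data (Sigma Gamma : finType) := PresentationData {
  copies : finType;
  arity : copies -> nat;
  dom_formula : mso Sigma 0 0;
  sel_formula : forall c, mso Sigma (arity c) 0;
  label_formula : forall c, Gamma -> mso Sigma (arity c) 0;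
  (* the first [arity c] variables are those of the smaller atom *)
  order_formula : forall c c', mso Sigma (arity c + arity c') 0
}.

Section Atoms.
Context {Sigma Gamma : finType} (p : presentation_data Sigma Gamma).
Variable w : seq Sigma.

Definition atom : finType :=
  {c : copies p & (arity c).-tuple 'I_(size w)}%type.

Definition selected : pred atom := fun a =>
  models w (sel_formula (tag a)) (tagged a).

Definition has_label (a : atom) (g : Gamma) : bool :=
  models w (label_formula (tag a) g) (tagged a).

Definition chi : rel atom := fun a b =>
  models w (order_formula (tag a) (tag b)) [tuple of tagged a ++ tagged b].

Definition in_domain : bool := models w (dom_formula p) [tuple].

(* Listing the selected atoms in increasing order for the strict order r;
   for well-formed presentations the [pick] always succeeds, with the unique
   label of the atom. *)
Definition output (r : rel atom) : seq Gamma :=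
  pmap (fun a => [pick g | has_label a g])
       (sort (fun a b => (a == b) || r a b) (enum selected)).

End Atoms.

Record presentation (Sigma Gamma : finType) := Presentation {
  pdata :> presentation_data Sigma Gamma;
  copies_nonempty : (0 < #|copies pdata|)%N;
  arity_gt0 : forall c : copies pdata, (0 < arity c)%N;
  label_unique : forall (w : seq Sigma) (a : atom pdata w),
    selected a -> exists! g, has_label a g;
  chi_linear : forall w : seq Sigma,
    strict_linear_on (@selected _ _ pdata w) (@chi _ _ pdata w)
}.

Definition polyregular_map (Sigma Gamma : finType)
    (p : presentation Sigma Gamma) : partial_map Sigma Gamma :=
  fun w => if in_domain p w then Some (output (@chi _ _ p w)) else None.

Definition polyregular (Sigma Gamma : finType)
    (f : partial_map Sigma Gamma) : Prop :=
  exists p : presentation Sigma Gamma, f =1 polyregular_map p.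

(** * Rank functions *)

Record rank_source (Sigma : finType) (d : nat) := RankSource {
  state : finType;
  init : state;
  trans : state -> Sigma -> state;
  weight : state -> Sigma -> 'rV[int]_d
}.

Definition state_before (Sigma : finType) (d : nat) (A : rank_source Sigma d)
    (w : seq Sigma) (i : nat) : state A :=
  foldl (@trans _ _ A) (init A) (take i w).

Definition prefix_rank (Sigma : finType) (d : nat) (A : rank_source Sigma d)
    (w : seq Sigma) (i : nat) : 'rV[int]_d :=
  \sum_(j < size w | (j < i)%N)
     weight (state_before A w j) (tnth (in_tuple w) j).

Record rank_function (Sigma : finType) (d k : nat) := RankFunction {
  rank_const : 'rV[int]_d;
  source : 'I_k -> rank_source Sigma d;
  table : forall r : 'I_k, state (source r) -> Sigma -> 'rV[int]_d
}.

Definition rank_value (Sigma : finType) (d k : nat)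
    (kappa : rank_function Sigma d k) (w : seq Sigma)
    (x : k.-tuple 'I_(size w)) : 'rV[int]_d :=
  rank_const kappa +
  \sum_(r < k) (prefix_rank (source kappa r) w (tnth x r) +
                table (state_before (source kappa r) w (tnth x r))
                      (tnth (in_tuple w) (tnth x r))).

Definition lex_lt (d : nat) (u v : 'rV[int]_d) : bool :=
  (([tuple u 0 i | i < d] : d.-tuplelexi int) < [tuple v 0 i | i < d])%O.

(** * WRP and sRR_1 *)

Record wrp_presentation (Sigma Gamma : finType) := WrpPresentation {
  wrp_base :> presentation Sigma Gamma;
  wrp_dim : nat;
  wrp_rank : forall c : copies wrp_base, rank_function Sigma wrp_dim (arity c)
}.

Definition wrp_lt (Sigma Gamma : finType) (p : wrp_presentation Sigma Gamma)
    (w : seq Sigma) : rel (atom p w) := fun a b =>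
  let u := rank_value (wrp_rank (tag a)) (tagged a) in
  let v := rank_value (wrp_rank (tag b)) (tagged b) in
  lex_lt u v || (u == v) && chi a b.

Definition wrp_map (Sigma Gamma : finType) (p : wrp_presentation Sigma Gamma) :
    partial_map Sigma Gamma :=
  fun w => if in_domain p w then Some (output (@wrp_lt _ _ p w)) else None.

Definition WRP (Sigma Gamma : finType) (f : partial_map Sigma Gamma) : Prop :=
  exists p : wrp_presentation Sigma Gamma, f =1 wrp_map p.

Definition first_pos (Sigma Gamma : finType) (p : presentation Sigma Gamma)
    (w : seq Sigma) (a : atom p w) : 'I_(size w) :=
  tnth (tagged a) (Ordinal (arity_gt0 (tag a))).

(* Only used for presentations all of whose arities are 1, where [first_pos]
   is the position of the atom. *)
Definition scan_order (Sigma Gamma : finType) (p : presentation Sigma Gamma) :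
    Prop :=
  exists (left_to_right : bool) (ltC : rel (copies p)),
    strict_linear_on predT ltC /\
    forall (w : seq Sigma),
      {in @selected _ _ p w &, forall a b,
         chi a b =
         (if left_to_right then (first_pos a < first_pos b)%N
          else (first_pos b < first_pos a)%N)
         || (first_pos a == first_pos b) && ltC (tag a) (tag b)}.

Definition sRR1 (Sigma Gamma : finType) (f : partial_map Sigma Gamma) : Prop :=
  exists p : wrp_presentation Sigma Gamma,
    [/\ forall c : copies p, arity c = 1%N, wrp_dim p = 1%N, scan_order p &
        f =1 wrp_map p].

(* Main.v *)
Require Import Defs.
From HB Require Import structures.
From mathcomp Require Import all_boot all_order all_algebra.
From mathcomp Require Import zify.

Set Implicit Arguments.
Unset Strict Implicit.
Unset Printing Implicit Defensive.

Import Order.TTheory GRing.Theory Num.Theory.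
Local Open Scope ring_scope.

(** Cut a path by starting height: its [level] at j is the word of the letters
    that start at height j, in reading order. The height sweep of a path that
    stays nonnegative is the concatenation of the reversed levels, by increasing
    j ([height_sweep_levels]), and everything about Dyck paths is read off this
    block decomposition.

    Bijectivity. In a Dyck path, each passage from height j to height j + 1 is
    matched by a return, so level j + 1 has as many D as level j has U
    ([count_level]), and for j > 0 the last visit to height j leaves downwards,
    so the reversed level, if not empty, starts with D ([last_level]). Hence the
    blocks can be cut out of the output one after the other ([flatten_inj]):
    block 0 has no D, the number of D in the next block is known from the
    present one, and a block ends right before the D that starts its successor.
    The levels determine the path, because reading the path amounts to popping
    the first letter of the level of the current height ([level_inj]). So the
    sweep is injective on Dyck paths of a given semilength, which it maps to
    themselves, and it is onto by finiteness.

    Statistics. A letter preceded by U inside its level starts at a height just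
    reached again from above, so it is preceded by D in the path, and conversely
    ([sum_factor_level]). Thus the factors UU of the levels are the valleys DU of
    the path, and the factors UD of the levels are the double falls DD, which are
    as many as the double rises. As blocks of positive height start with D, the
    factors UU and DU of the output lie inside blocks, and reversal fixes UU and
    exchanges DU and UD.

    Failure of polyregularity. MSO properties of words are recognised by finite
    automata, also with free variables, which become marks on the letters
    ([definable_mso]). A first-order property of the output of a polyregular map
    pulls back to an MSO property of the input, where quantifying over an atom
    means choosing a copy name and quantifying over its positions. So a finite
    automaton decides on the input w whether the last letter but one of the
    output is U ([regular_penultimate]). Now let w consist of a mountain
    of height b followed by a mountain of height a whose top is notched. If b > a,
    the highest level has the single letter D and the next one starts with U, so
    the sweep ends with UD; if b = a, three D start at height a, and it ends with
    DD. An automaton reading the first mountain from left to right confuses two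
    heights a < b by the pigeonhole principle. *)

(** * Levels of a path *)

Definition rise (w : seq step) : int := (count_mem U w)%:Z - (count_mem D w)%:Z.

Definition slope (x : step) : int := if x is U then 1 else -1.

Lemma rise_cat u v : rise (u ++ v) = rise u + rise v.
Proof. rewrite /rise !count_cat; lia. Qed.

Lemma rise_cons x w : rise (x :: w) = slope x + rise w.
Proof. by rewrite /rise; case: x => /=; lia. Qed.

Lemma rise_rcons w x : rise (rcons w x) = rise w + slope x.
Proof. by rewrite -cats1 rise_cat rise_cons /rise /= subrr addr0. Qed.

Lemma heightE w k : height w k = rise (take k w).
Proof. by []. Qed.

Lemma height_rcons w x i : (i <= size w)%N -> height (rcons w x) i = height w i.
Proof. by move=> lei; rewrite /height -cats1 takel_cat. Qed.

Lemma step_eqE :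
  ((U == U) = true) * ((D == D) = true) * ((U == D) = false) * ((D == U) = false).
Proof. by []. Qed.

Fixpoint level (h : int) (w : seq step) (j : nat) : seq step :=
  if w is x :: w' then
    if h == j%:Z then x :: level (h + slope x) w' j
    else level (h + slope x) w' j
  else [::].

Lemma level_cat h u v j :
  level h (u ++ v) j = level h u j ++ level (h + rise u) v j.
Proof.
elim: u h => [|x u IH] h /=; first by rewrite /rise addr0.
by rewrite rise_cons addrA IH; case: ifP.
Qed.

Lemma level_rcons h w x j :
  level h (rcons w x) j =
  if h + rise w == j%:Z then rcons (level h w j) x else level h w j.
Proof. by rewrite -cats1 level_cat /=; case: ifP; rewrite ?cats1 ?cats0. Qed.

Lemma level_filter w j :
  level 0 w j = [seq nth U w i | i <- iota 0 (size w) & height w i == j%:Z].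
Proof.
elim/last_ind: w => [|w x IH] //.
rewrite level_rcons size_rcons -addn1 iotaD filter_cat map_cat /= add0n add0r.
have -> : [seq nth U (rcons w x) i
            | i <- iota 0 (size w) & height (rcons w x) i == j%:Z] = level 0 w j.
  rewrite IH.
  have -> : [seq i <- iota 0 (size w) | height (rcons w x) i == j%:Z] =
            [seq i <- iota 0 (size w) | height w i == j%:Z].
    apply: eq_in_filter => i; rewrite mem_iota => /andP[_ lti].
    by rewrite height_rcons // ltnW.
  apply/eq_in_map => i; rewrite mem_filter mem_iota => /andP[_ /andP[_ lti]].
  by rewrite nth_rcons lti.
rewrite height_rcons // heightE take_size.
by case: ifP => _ /=; rewrite ?cats0 // nth_rcons ltnn eqxx cats1.
Qed.

(** Nonnegativity matters: levels are indexed by natural numbers, so letters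
    that start below 0 are seen by no level. *)
Lemma level_inj h u v : (forall j : nat, level h u j = level h v j) ->
  (forall k, 0 <= h + height u k) -> (forall k, 0 <= h + height v k) -> u = v.
Proof.
elim: u v h => [|x u IH] [|y v] h //=.
- move=> E _ /(_ 0); rewrite /height /= addr0 => h0.
  by have := E `|h|%N; case: ifP => //; lia.
- move=> E /(_ 0); rewrite /height /= addr0 => h0 _.
  by have := E `|h|%N; case: ifP => //; lia.
move=> E nnu nnv.
have h0: 0 <= h by have := nnu 0; rewrite /height /= addr0.
have exy: x = y by have := E `|h|%N; case: ifP; [move=> _ [] | lia].
subst y; congr (_ :: _); apply: (IH _ (h + slope x)).
- by move=> j; have := E j; case: ifP => // _ [].
- by move=> k; have := nnu k.+1; rewrite !heightE /= rise_cons addrA.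
by move=> k; have := nnv k.+1; rewrite !heightE /= rise_cons addrA.
Qed.

(** * The sweep as a concatenation of reversed levels *)

(** The sorting criterion of [height_sweep], on plain positions. *)
Definition sweep_le (w : seq step) : rel nat := fun i j =>
  (height w i < height w j) || (height w i == height w j) && (j <= i)%N.

Lemma sweep_le_total w : total (sweep_le w).
Proof. move=> i j; rewrite /sweep_le; lia. Qed.
Lemma sweep_le_trans w : transitive (sweep_le w).
Proof. move=> i j k; rewrite /sweep_le; lia. Qed.
Lemma sweep_le_anti w : antisymmetric (sweep_le w).
Proof. move=> i j; rewrite /sweep_le; lia. Qed.

Lemma height_sweepE w :
  height_sweep w = [seq nth U w i | i <- sort (sweep_le w) (iota 0 (size w))].
Proof.
rewrite -val_enum_ord sort_map -map_comp /height_sweep.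
by apply: eq_map => i /=; rewrite (tnth_nth U).
Qed.

Lemma perm_height_sweep w : perm_eq (height_sweep w) w.
Proof.
rewrite height_sweepE -[X in perm_eq _ X](mkseq_nth U w) /mkseq.
by apply: perm_map; rewrite perm_sort.
Qed.

(** Both sides list the same positions, and both are sorted for a total order. *)
Lemma height_sweep_levels w N :
  (forall i, (i < size w)%N -> 0 <= height w i < N%:Z) ->
  height_sweep w = flatten [seq rev (level 0 w j) | j <- iota 0 N].
Proof.
move=> bnd; rewrite height_sweepE.
pose B j := rev [seq i <- iota 0 (size w) | height w i == j%:Z].
have -> : [seq rev (level 0 w j) | j <- iota 0 N] =
          [seq map (nth U w) (B j) | j <- iota 0 N].
  by apply: eq_map => j; rewrite level_filter map_rev.
rewrite (map_comp (map (nth U w)) B) -map_flatten; congr map.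
(* the strict order of the sweep: it also shows that no position is repeated *)
pose lt i j := (height w i < height w j) ||
               (height w i == height w j) && (j < i)%N.
have memB i m n : (i \in flatten [seq B j | j <- iota m n]) =
   (i < size w)%N && (m%:Z <= height w i < (m + n)%N%:Z).
  elim: n m => [|n IH] m /=.
    by rewrite in_nil addn0; lia.
  by rewrite mem_cat IH mem_rev mem_filter mem_iota; lia.
have pw m n : pairwise lt (flatten [seq B j | j <- iota m n]).
  elim: n m => [|n IH] m //=.
  rewrite pairwise_cat IH andbT; apply/andP; split.
    apply/allrelP => i k; rewrite mem_rev mem_filter memB => /andP[Hi _] Hk.
    by rewrite /lt; lia.
  rewrite /B -filter_rev.
  rewrite (@sub_in_pairwise _ [pred i | height w i == m%:Z] gtn) //.
  - by move=> i k; rewrite !inE /lt => Hi Hk; lia.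
  - by rewrite all_filter; apply/allP => i _ /=; apply/implyP.
  rewrite -sorted_pairwise; last by move=> ? ? ?; lia.
  apply: sorted_filter; first by move=> ? ? ?; lia.
  by rewrite rev_sorted; apply: iota_ltn_sorted.
apply: (@sorted_eq _ (sweep_le w)).
- exact: sweep_le_trans.
- exact: sweep_le_anti.
- exact/sort_sorted/sweep_le_total.
- rewrite sorted_pairwise; last exact: sweep_le_trans.
  by apply: sub_pairwise (pw 0 N) => i j; rewrite /lt /sweep_le; lia.
rewrite perm_sort; apply: uniq_perm; first exact: iota_uniq.
  apply: (@pairwise_uniq _ lt); last exact: pw.
  by move=> i; rewrite /lt; lia.
move=> i; rewrite memB mem_iota add0n.
by case: (ltnP i (size w)) => // /bnd; lia.
Qed.

(** * Invariants of the levels *)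

(** Extending w by one letter changes only the level of the current height, so
    this invariant passes from prefix to prefix: a height below the current one was
    last left upwards, a height above it was last left downwards or never
    visited, and the current height was last left upwards exactly when it has
    just been reached from above. The default values D of the level and U of w
    stand for a height that was not visited yet and for the start of the path. *)
Lemma last_level w (j : nat) :
  (last D (level 0 w j) == U) =
  (j%:Z < rise w) || (j%:Z == rise w) && (last U w == D).
Proof.
have [DU UD] : (D == U) = false /\ (U == D) = false by [].
elim/last_ind: w => [|w x IH]; first by rewrite /rise /= DU UD; lia.
rewrite level_rcons rise_rcons !last_rcons add0r.
case: ifP => H; rewrite ?last_rcons ?IH; move: H; case: x;
  case: (last U w); rewrite ?eqxx ?DU ?UD /=; lia.
Qed.

(** Steps between heights j and j + 1 alternate between up and down, starting
    with up. *)
Lemma count_level w (j : nat) :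
  count_mem U (level 0 w j) =
  (count_mem D (level 0 w j.+1) + (j%:Z < rise w)%R)%N.
Proof.
have [DU UD] : (D == U) = false /\ (U == D) = false by [].
elim/last_ind: w => [|w x IH]; first by rewrite /rise /=; lia.
rewrite !level_rcons rise_rcons add0r.
case: ifP => H1; case: ifP => H2; rewrite -?cats1 ?count_cat; case: x H1 H2 => /=;
  rewrite ?eqxx ?DU ?UD; rewrite IH;
  move: (count_mem D _) (rise w) => n r /=; clear; lia.
Qed.

(** * Occurrences of two-letter factors *)

Lemma factor_cat a b s t :
  factor_count a b (s ++ t) =
  (factor_count a b s + factor_count a b t +
   [&& s != [::], t != [::], last D s == a & head D t == b])%N.
Proof.
elim: s => [|x s IH] //=; first by rewrite addn0.
case: s IH => [|y s] IH.
  case: t {IH} => [|z t]; rewrite /factor_count //=.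
  by rewrite xpair_eqE; lia.
rewrite /= in IH *; rewrite /factor_count /= in IH *; rewrite IH.
lia.
Qed.

Lemma factor_rcons a b s x :
  factor_count a b (rcons s x) =
  (factor_count a b s + [&& s != [::], last D s == a & x == b])%N.
Proof. by rewrite -cats1 factor_cat /= addn0. Qed.

(** Each U is followed by U, followed by D, or last. *)
Lemma count_rise w : count_mem U w =
  (factor_count U U w + factor_count U D w + (last D w == U))%N.
Proof.
elim/last_ind: w => [|w x IH] //.
rewrite !factor_rcons last_rcons -cats1 count_cat IH.
case: w {IH} => [|y w]; first by case: x.
by rewrite /=; case: x; case: (last y w) => /=; rewrite ?step_eqE /=; lia.
Qed.

(** Each D is preceded by U, preceded by D, or first. *)
Lemma count_fall w : count_mem D w =
  (factor_count U D w + factor_count D D w + (head U w == D))%N.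
Proof.
elim: w => [|x w IH] //.
rewrite -[x :: w]cat1s !factor_cat count_cat IH.
have one a b y : factor_count a b [:: y] = 0%N by [].
rewrite /=; case: w {IH} => [|y w]; case: x => //=; rewrite ?step_eqE //=.
all: by case: y; rewrite /= ?step_eqE !one; clear; lia.
Qed.

Lemma factor_rev a b s : factor_count a b (rev s) = factor_count b a s.
Proof.
elim: s => [|x s IH] //.
rewrite rev_cons -cats1 factor_cat IH -[x :: s]cat1s factor_cat.
rewrite -!size_eq0 size_rev /= addn0 add0n; congr (_ + _)%N.
by case: s {IH} => //= y s; rewrite rev_cons last_rcons andbC.
Qed.

(** Reading a letter x at height h appends x to level h. By [last_level], the
    previous letter of that level is U exactly when the previous step of w is D,
    so one more factor Ux in the levels goes with one more factor Dx in w. *)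
Lemma sum_factor_level w x N :
  (forall i, (i < size w)%N -> 0 <= height w i < N%:Z) ->
  (\sum_(0 <= j < N) factor_count U x (level 0 w j) = factor_count D x w)%N.
Proof.
elim/last_ind: w => [|w y IH] bnd; first by rewrite big1.
rewrite factor_rcons -IH; last first.
  move=> i lti; rewrite -(height_rcons y (ltnW lti)).
  by apply: bnd; rewrite size_rcons; apply: leqW.
have := bnd (size w); rewrite size_rcons ltnSn heightE -cats1 take_size_cat //.
move=> /(_ isT)/andP[]; case E: (rise w) => [h|//] _ ltN.
have hN : (0 <= h < N)%N by lia.
rewrite (bigD1_seq h) ?mem_index_iota ?iota_uniq //=.
rewrite [in RHS](bigD1_seq h) ?mem_index_iota ?iota_uniq //=.
rewrite cats1 level_rcons add0r E eqxx factor_rcons addnAC.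
congr (_ + _ + _)%N.
  apply: eq_bigr => j nej; rewrite level_rcons add0r E.
  by rewrite eqz_nat eq_sym (negbTE nej).
have lastE : last D (level 0 w h) == U = (last U w == D).
  by rewrite last_level E ltxx eqxx.
rewrite !andbA; congr (nat_of_bool (_ && _)).
have -> : (level 0 w h != [::]) && (last D (level 0 w h) == U) =
          (last D (level 0 w h) == U) by case: (level 0 w h).
by rewrite lastE; case: (w).
Qed.

(** * Concatenations of blocks *)

(** A block that starts with D contributes no factor across its left border
    that ends with U; an empty block has no border. *)
Lemma factor_flatten a (B : nat -> seq step) N :
  (forall j, (0 < j)%N -> head D (B j) = D) ->
  factor_count a U (flatten [seq B j | j <- iota 0 N]) =
  (\sum_(0 <= j < N) factor_count a U (B j))%N.
Proof.
move=> hB; elim: N => [|N IH]; first by rewrite big_nil.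
rewrite big_nat_recr // -[in LHS]addn1 iotaD map_cat flatten_cat /= cats0 add0n.
rewrite factor_cat IH; case: N {IH} => [|N]; first by rewrite big_nil /= addn0.
by rewrite hB // !andbF addn0.
Qed.

(** If s1 were shorter than s2, then s2 would contain the D that starts t1.
    The default value D of [head] lets t1 and t2 be empty. *)
Lemma cat_cut (s1 s2 t1 t2 : seq step) :
  s1 ++ t1 = s2 ++ t2 -> count_mem D s1 = count_mem D s2 ->
  head D t1 = D -> head D t2 = D -> s1 = s2 /\ t1 = t2.
Proof.
wlog: s1 s2 t1 t2 / (size s1 <= size s2)%N.
  move=> Hwlog; case: (leqP (size s1) (size s2)) => [|/ltnW] le E ec h1 h2.
    exact: Hwlog.
  by case: (Hwlog _ _ _ _ le (esym E) (esym ec) h2 h1).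
move=> le E ec h1 _.
have Es : s2 = s1 ++ take (size s2 - size s1) t1.
  have := congr1 (take (size s2)) E.
  by rewrite (@take_size_cat _ _ s2 t2) // take_cat ltnNge le.
have Et : take (size s2 - size s1) t1 = [::].
  move: (size s2 - size s1)%N Es => k Es.
  move: ec; rewrite Es count_cat; case: t1 h1 {E Es} => // x t1 /= ->.
  by case: k => //= k; lia.
move: Es; rewrite Et cats0 => Es; split=> //.
by move: E; rewrite Es => /eqP; rewrite eqseq_cat // eqxx => /eqP.
Qed.

(** Cuts off one block after the other with [cat_cut]: the U of a block are as
    many as the D of the next one, which is the count that the next cut needs. *)
Lemma flatten_inj (B C : nat -> seq step) m n :
  (forall j, (m < j)%N -> head D (B j) = D) ->
  (forall j, (m < j)%N -> head D (C j) = D) ->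
  (forall j, count_mem D (B j.+1) = count_mem U (B j)) ->
  (forall j, count_mem D (C j.+1) = count_mem U (C j)) ->
  count_mem D (B m) = count_mem D (C m) ->
  flatten [seq B j | j <- iota m n] = flatten [seq C j | j <- iota m n] ->
  forall j, (m <= j < m + n)%N -> B j = C j.
Proof.
have headF (A : nat -> seq step) k l : (forall j, (k <= j)%N -> head D (A j) = D) ->
    head D (flatten [seq A j | j <- iota k l]) = D.
  elim: l k => [|l IH] k hA //=; have := hA k (leqnn k).
  case: (A k) => //= _; apply: IH => j lej; apply: hA; exact: ltnW.
move=> hB hC cB cC; elim: n m hB hC => [|n IH] m hB hC ec E j.
  by rewrite addn0; lia.
have /= [EB EF] := cat_cut E ec (headF _ _ _ hB) (headF _ _ _ hC).
rewrite leq_eqVlt => /andP[/orP[/eqP <- //|ltj] lej].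
apply: (IH m.+1) => //.
- by move=> i lei; apply: hB; apply: ltnW.
- by move=> i lei; apply: hC; apply: ltnW.
- by rewrite cB cC EB.
by rewrite ltj; lia.
Qed.

(** The D of a block never outnumber the U of the previous block, so these U
    keep the height nonnegative inside the block. *)
Lemma flatten_nonneg (B : nat -> seq step) m n :
  (forall j, count_mem D (B j.+1) = count_mem U (B j)) ->
  forall k, 0 <= (count_mem D (B m))%:Z +
                 height (flatten [seq B j | j <- iota m n]) k.
Proof.
move=> cB; elim: n m => [|n IH] m k.
  by rewrite /height /=; lia.
rewrite heightE /= take_cat; case: ltnP => lek.
  rewrite /rise -[in X in _ <= X + _](cat_take_drop k (B m)) count_cat.
  have aux (a b c : nat) : 0 <= (a + b)%N%:Z + (c%:Z - a%:Z) by lia.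
  exact: aux.
have E : (count_mem D (B m))%:Z + rise (B m) = (count_mem U (B m))%:Z.
  by rewrite /rise addrC subrK.
by have := IH m.+1 (k - size (B m))%N; rewrite cB -E -addrA heightE rise_cat.
Qed.

(** * The sweep on Dyck paths *)

Lemma dyckP n w :
  reflect [/\ forall k, 0 <= height w k, rise w = 0 & size w = n.*2] (w \in dyck n).
Proof.
have szw : size w = (count_mem U w + count_mem D w)%N.
  rewrite -(count_predC (pred1 U)); congr addn.
  by apply: eq_count; case.
apply: (iffP and4P) => [[/eqP sz /eqP cU /eqP cD /allP nn]|[nn r0 sz]].
  split=> //; last by rewrite /rise cU cD subrr.
  move=> k; case: (leqP k (size w)) => lek; first by apply: nn; rewrite mem_iota.
  rewrite heightE take_oversize 1?ltnW // -(take_size w).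
  by apply: nn; rewrite mem_iota leqnn.
move: r0; rewrite /rise => r0.
split; [exact/eqP | lia | lia | by apply/allP => k _; apply: nn].
Qed.

Section DyckSweep.
Variables (n : nat) (P : seq step).
Hypothesis dyck_path : P \in dyck n.

Let block j := rev (level 0 P j).

Lemma dyck_height_bound i : (i < size P)%N -> 0 <= height P i < (n.*2)%:Z.
Proof.
have [nn _ sz] := dyckP _ _ dyck_path; rewrite sz => lti; rewrite nn /=.
rewrite /height; have := count_size (pred1 U) (take i P).
rewrite size_take sz lti; lia.
Qed.

Lemma sweep_blocks : height_sweep P = flatten [seq block j | j <- iota 0 n.*2].
Proof. exact/height_sweep_levels/dyck_height_bound. Qed.

Lemma head_block j : (0 < j)%N -> head D (block j) = D.
Proof.
have [_ r0 _] := dyckP _ _ dyck_path.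
have := last_level P j; rewrite r0 /block => H j0.
case/lastP: (level 0 P j) H => // s x; rewrite last_rcons rev_rcons /=.
by case: x => //; rewrite step_eqE; lia.
Qed.

Lemma count_block j : count_mem D (block j.+1) = count_mem U (block j).
Proof.
have [_ r0 _] := dyckP _ _ dyck_path.
by rewrite /block !count_rev count_level r0 addn0.
Qed.

Lemma count_block0 : count_mem D (block 0) = 0%N.
Proof.
have [nn _ _] := dyckP _ _ dyck_path.
rewrite count_rev level_filter; apply/eqP; rewrite -leqn0 leqNgt -has_count.
apply/hasPn => x /mapP[i]; rewrite mem_filter mem_iota => /andP[/eqP hi lti] ->.
have := nn i.+1; rewrite heightE (take_nth U) // rise_rcons -heightE hi.
by case: (nth U P i).
Qed.

Lemma sweep_dyck : height_sweep P \in dyck n.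
Proof.
have [_ r0 sz] := dyckP _ _ dyck_path.
have pe := perm_height_sweep P.
apply/dyckP; split; last by rewrite (perm_size pe).
  move=> k; rewrite sweep_blocks.
  by have := flatten_nonneg 0 n.*2 count_block k; rewrite count_block0 add0r.
by rewrite /rise !(permP pe).
Qed.

(** In a nonempty Dyck path the last letter is D and the first one is U, so
    the U that are not followed by U are as many as the D that are not preceded
    by D; and there are as many U as D. *)
Lemma dyck_double_falls : factor_count D D P = factor_count U U P.
Proof.
have [nn r0 _] := dyckP _ _ dyck_path.
have lastP : (last D P == U) = false.
  case/lastP: (P) nn r0 => // s x nn; rewrite rise_rcons last_rcons.
  have := nn (size s); rewrite heightE -cats1 take_size_cat //.
  by case: x {nn} => //=; lia.
have headP : (head U P == D) = false.
  by case: (P) nn => // -[] // s /(_ 1%N); rewrite heightE /= take0.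
have := count_rise P; have := count_fall P.
by rewrite lastP headP; move: r0; rewrite /rise; clear; lia.
Qed.

Lemma sweep_stats : double_rises (height_sweep P) = valleys P /\
                    valleys (height_sweep P) = double_rises P.
Proof.
rewrite /double_rises /valleys sweep_blocks !factor_flatten; try exact: head_block.
rewrite -dyck_double_falls.
rewrite -(sum_factor_level U dyck_height_bound).
rewrite -(sum_factor_level D dyck_height_bound).
by split; apply: eq_bigr => j _; rewrite factor_rev.
Qed.

End DyckSweep.

Lemma sweep_inj n : {in dyck n &, injective height_sweep}.
Proof.
move=> P Q dP dQ; rewrite (sweep_blocks dP) (sweep_blocks dQ) => E.
have [nnP _ szP] := dyckP _ _ dP; have [nnQ _ szQ] := dyckP _ _ dQ.
apply: (@level_inj 0) => [j|k|k]; rewrite ?add0r //.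
case: (ltnP j n.*2) => [ltj|lej].
  apply: (can_inj (@revK _)); apply: (flatten_inj _ _ _ _ _ E).
  - by move=> i; apply: (head_block dP).
  - by move=> i; apply: (head_block dQ).
  - exact: (count_block dP).
  - exact: (count_block dQ).
  - by rewrite (count_block0 dP) (count_block0 dQ).
  by [].
have emp R : R \in dyck n -> level 0 R j = [::].
  move=> dR; have [nnR _ szR] := dyckP _ _ dR.
  rewrite level_filter (_ : filter _ _ = [::]) //.
  apply/eqP; rewrite -[_ == _]negbK -has_filter; apply/hasPn => i.
  rewrite mem_iota => /andP[_ lti].
  by have := dyck_height_bound dR lti; lia.
by rewrite !emp.
Qed.

Lemma size_height_sweep_tuple n (P : n.-tuple step) : size (height_sweep P) == n.
Proof. by rewrite (perm_size (perm_height_sweep P)) size_tuple. Qed.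

(** The identity outside of Dyck words makes this a self-map of a finite type,
    which is a permutation as soon as it is injective. *)
Definition dyck_sweep n (P : (n.*2).-tuple step) : (n.*2).-tuple step :=
  if tval P \in dyck n then Tuple (size_height_sweep_tuple P) else P.

Lemma dyck_sweep_mem n (P : (n.*2).-tuple step) :
  (tval (dyck_sweep P) \in dyck n) = (tval P \in dyck n).
Proof. by rewrite /dyck_sweep; case: ifP => // dP; apply: sweep_dyck. Qed.

Lemma dyck_sweep_inj n : injective (@dyck_sweep n).
Proof.
move=> P Q E; have := dyck_sweep_mem P; rewrite E dyck_sweep_mem => dPQ.
move: E; rewrite /dyck_sweep dPQ; case: ifP => // dP /(congr1 val) /= E.
by apply: val_inj; apply: (@sweep_inj n) E; rewrite /= ?dPQ.
Qed.

Lemma sweep_surj n : {in dyck n, forall Q, exists2 P, P \in dyck n & height_sweep P = Q}.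
Proof.
move=> Q dQ; have /eqP sQ : size Q = n.*2 by have [] := dyckP _ _ dQ.
have [g _ gK] := injF_bij (@dyck_sweep_inj n).
have := dyck_sweep_mem (g (Tuple sQ)); rewrite gK dQ => /esym dg.
exists (g (Tuple sQ)) => //.
by have := congr1 val (gK (Tuple sQ)); rewrite /dyck_sweep dg.
Qed.

(** The sweep permutes the index set and exchanges the two exponents. *)
Lemma narayana_symmetry (R : comNzRingType) (q t : R) n :
  \sum_(P : (n.*2).-tuple step | tval P \in dyck n)
     q ^+ valleys P * t ^+ double_rises P =
  \sum_(P : (n.*2).-tuple step | tval P \in dyck n)
     q ^+ double_rises P * t ^+ valleys P.
Proof.
rewrite (reindex_inj (@dyck_sweep_inj n)) /=.
apply: eq_big => P; first exact: dyck_sweep_mem.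
rewrite dyck_sweep_mem /dyck_sweep => dP; rewrite dP /=.
by have [-> ->] := sweep_stats dP.
Qed.

(** * The sweep as a rank-ordered presentation *)

(** One copy name, of arity 1: every position is an atom with its own letter,
    and atoms are ordered from right to left. The equation x = x serves as the
    true formula. *)
Definition sweep_data : presentation_data step step :=
  @PresentationData step step unit (fun _ => 1%N)
    (MAllPos (MEq step 0 ord0 ord0))
    (fun _ => MEq step 0 ord0 ord0)
    (fun _ g => MLetter 0 g ord0)
    (* variable 1 belongs to the larger atom, which lies further to the left *)
    (fun _ _ => MLt step 0 (ord_max : 'I_(1 + 1)) ord0).

Lemma sweep_chi w (a b : atom sweep_data w) :
  chi a b = (tnth (tagged b) ord0 < tnth (tagged a) ord0)%N.
Proof.
case: a b => [[] x] [[] y]; case/tupleP: x => i x; case/tupleP: y => j y.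
by rewrite (tuple0 x) (tuple0 y) /chi /models /= !(tnth_nth i).
Qed.

Lemma sweep_selected w (a : atom sweep_data w) : selected a.
Proof. by rewrite /selected /models /= eqxx. Qed.

Lemma sweep_atom_inj w :
  injective (fun a : atom sweep_data w => tnth (tagged a) ord0).
Proof.
case=> [[] x] [[] y] /= E; congr existT.
by apply: eq_from_tnth => i; rewrite (ord1 i).
Qed.

Lemma sweep_label_unique (w : seq step) (a : atom sweep_data w) :
  selected a -> exists! g, has_label a g.
Proof.
move=> _; exists (tnth (in_tuple w) (tnth (tagged a) ord0)).
by split=> [|g]; rewrite /has_label /models /= // => /eqP.
Qed.

Lemma sweep_chi_linear (w : seq step) :
  strict_linear_on (@selected _ _ sweep_data w) (@chi _ _ sweep_data w).
Proof.
split.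
- by move=> a _; rewrite sweep_chi ltnn.
- by move=> b a c _ _ _; rewrite !sweep_chi => ? ?; lia.
move=> a b _ _ neab; rewrite !sweep_chi.
case: ltngtP => // E; case/eqP: neab; apply: sweep_atom_inj; exact: val_inj.
Qed.

Lemma sweep_copies_nonempty : (0 < #|copies sweep_data|)%N.
Proof. by rewrite card_unit. Qed.

Definition sweep_presentation : presentation step step :=
  Presentation (pdata := sweep_data) sweep_copies_nonempty
    (fun _ => isT) sweep_label_unique sweep_chi_linear.

(** With weight 1 for U and -1 for D, the prefix rank of a position is its
    starting height. *)
Definition height_source : rank_source step 1 :=
  @RankSource step 1 unit tt (fun _ _ => tt) (fun _ x => (slope x)%:M).

Lemma prefix_rank_height w i : (i <= size w)%N ->
  prefix_rank height_source w i = (height w i)%:M.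
Proof.
elim: i => [|i IH] lti; rewrite /prefix_rank.
  by rewrite big_pred0 // heightE take0 raddf0.
rewrite (bigD1 (Ordinal lti)) //=.
rewrite (eq_bigl (fun j : 'I_(size w) => (j < i)%N)); last first.
  by move=> j; rewrite -val_eqE /=; lia.
rewrite [X in _ + X](IH (ltnW lti)) (heightE w i.+1) (take_nth U) // rise_rcons.
rewrite -heightE (tnth_nth U) /=; apply/matrixP => k l.
by rewrite !mxE -mulrnDl addrC.
Qed.

Definition sweep_wrp : wrp_presentation step step :=
  @WrpPresentation step step sweep_presentation 1
    (fun _ => @RankFunction step 1 1 0 (fun _ => height_source) (fun _ _ _ => 0)).

Lemma sweep_wrp_lt w (a b : atom sweep_wrp w) :
  wrp_lt a b =
  (height w (tnth (tagged a) ord0) < height w (tnth (tagged b) ord0)) ||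
  (height w (tnth (tagged a) ord0) == height w (tnth (tagged b) ord0)) &&
  (tnth (tagged b) ord0 < tnth (tagged a) ord0)%N.
Proof.
have rankE (c : atom sweep_wrp w) :
    rank_value (wrp_rank (tag c)) (tagged c) =
    (height w (tnth (tagged c) ord0))%:M.
  rewrite /rank_value /= add0r big_ord1 addr0 prefix_rank_height //.
  exact: ltnW.
rewrite /wrp_lt !rankE sweep_chi; congr (_ || (_ && _)).
  rewrite /lex_lt.
  apply/ltxi_tuplePlt/idP => [[k _]|lt]; last exists ord0.
  - by rewrite !tnth_mktuple !mxE (ord1 k).
  - by case.
  - by rewrite !tnth_mktuple !mxE.
apply/eqP/eqP => [/matrixP/(_ ord0 ord0)|-> //].
by rewrite !mxE eqxx.
Qed.

Lemma sweep_sRR1 : sRR1 (fun w : seq step => Some (height_sweep w)).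
Proof.
exists sweep_wrp; split=> //.
  exists false, (fun _ _ => false); split.
    by split.
  move=> w a b _ _; rewrite sweep_chi /= andbF orbF.
  have E (c : atom sweep_wrp w) : first_pos c = tnth (tagged c) ord0.
    by congr tnth; apply: val_inj.
  by rewrite !E.
move=> w; rewrite /wrp_map /in_domain /models /=.
have -> : [forall i : 'I_(size w), tnth [tuple of i :: [tuple]] ord0 ==
             tnth [tuple of i :: [tuple]] ord0] by apply/forallP => i.
congr Some; rewrite /output /height_sweep.
pose pos (a : atom sweep_wrp w) := tnth (tagged a) ord0.
set leS := (fun i j : 'I_(size w) => _).
set leW := (fun a b : atom sweep_wrp w => _).
have leWE a b : leW a b = leS (pos a) (pos b).
  rewrite /leW sweep_wrp_lt /leS /pos.
  rewrite -(inj_eq (@sweep_atom_inj w)) /=.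
  move: (tnth _ _) (tnth _ _) => i j.
  by have [->|] := eqVneq i j; [rewrite ltxx eqxx leqnn | rewrite -val_eqE /=; lia].
have -> : sort leS (enum 'I_(size w)) =
          map pos (sort leW (enum (@selected _ _ sweep_wrp w))).
  apply: (@sorted_eq _ leS).
  - by move=> i j k; rewrite /leS; lia.
  - by move=> i j H; apply: val_inj; move: H; rewrite /leS /=; lia.
  - by apply: sort_sorted => i j; rewrite /leS; lia.
  - rewrite sorted_map; apply: (@sub_sorted _ leW) => [a b|]; first by rewrite leWE.
    by apply: sort_sorted => a b; rewrite !leWE /leS; lia.
  rewrite perm_sort; apply: uniq_perm; rewrite ?enum_uniq //.
    by rewrite map_inj_uniq ?sort_uniq ?enum_uniq //; apply: sweep_atom_inj.
  move=> i; rewrite mem_enum inE; apply/esym/mapP.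
  exists (existT _ tt [tuple i]) => //.
  by rewrite mem_sort mem_enum; apply: sweep_selected.
rewrite -map_comp; elim: (sort _ _) => //= a s ->.
have -> : [pick g | has_label (p := sweep_data) (w := w) a g] =
          Some (tnth (in_tuple w) (pos a)).
  have [g lg|/(_ (tnth (in_tuple w) (pos a)))] := pickP.
    by congr Some; apply/esym/eqP.
  by rewrite /has_label /models /= eqxx.
by [].
Qed.

Lemma sRR1_WRP (Sigma Gamma : finType) (f : partial_map Sigma Gamma) :
  sRR1 f -> WRP f.
Proof. by case=> p [_ _ _ fE]; exists p. Qed.

(** * Regular languages *)

Definition regular (A : Type) (L : seq A -> bool) : Prop :=
  exists (S : finType) (s0 : S) (d : S -> A -> S) (acc : pred S),
    forall u, L u = acc (foldl d s0 u).

Section RegularClosure.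
Variable A : Type.
Implicit Types L : seq A -> bool.

Lemma regular_ext L L' : L =1 L' -> regular L -> regular L'.
Proof.
by move=> E [S [s0 [d [acc H]]]]; exists S, s0, d, acc => u; rewrite -E H.
Qed.

Lemma regular_true : regular (fun _ : seq A => true).
Proof. by exists unit, tt, (fun _ _ => tt), predT. Qed.

Lemma regular_not L : regular L -> regular (fun u => ~~ L u).
Proof.
by case=> S [s0 [d [acc H]]]; exists S, s0, d, (predC acc) => u; rewrite H.
Qed.

Lemma regular_and L L' : regular L -> regular L' -> regular (fun u => L u && L' u).
Proof.
case=> S [s0 [d [acc H]]] [S' [s0' [d' [acc' H']]]].
exists (S * S')%type, (s0, s0'), (fun s a => (d s.1 a, d' s.2 a)).
exists (fun s => acc s.1 && acc' s.2) => u; rewrite H H'.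
by elim: u s0 s0' {H H'} => //= a u IH s0 s0'; apply: IH.
Qed.

Lemma regular_all (I : Type) (L : I -> seq A -> bool) (s : seq I) :
  (forall i, regular (L i)) -> regular (fun u => all (fun i => L i u) s).
Proof.
move=> rL; elim: s => [|i s IH] /=; first exact: regular_true.
exact: regular_and.
Qed.

Lemma regular_preim (B : Type) (f : B -> A) L :
  regular L -> regular (fun u => L (map f u)).
Proof.
case=> S [s0 [d [acc H]]]; exists S, s0, (fun s b => d s (f b)), acc => u.
by rewrite H; elim: u s0 {H} => //= b u IH s0; apply: IH.
Qed.

Lemma regular_has (P : pred A) : regular (has P).
Proof.
exists bool, false, (fun s a => s || P a), id => u.
elim/last_ind: u => // u a IH; rewrite foldl_rcons -IH has_rcons orbC //.
Qed.

Fixpoint before (P Q : pred A) (u : seq A) : bool :=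
  if u is a :: u' then P a && has Q u' || before P Q u' else false.

Lemma before_rcons P Q u a :
  before P Q (rcons u a) = before P Q u || has P u && Q a.
Proof.
elim: u => [|b u IH] /=; first by rewrite andbF.
rewrite has_rcons IH; case: (P b); case: (Q a); case: (has Q u);
  by rewrite /= ?orbT ?andbT ?andbF ?orbF.
Qed.

Lemma beforeP P Q x0 u :
  reflect (exists i j, [&& (i < j)%N, (j < size u)%N, P (nth x0 u i) & Q (nth x0 u j)])
          (before P Q u).
Proof.
elim: u => [|a u IH] /=; first by constructor=> -[i [j]]; rewrite andbF.
apply: (iffP orP) => [[/andP[Pa /(has_nthP x0)[j ltj Qj]]|/IH[i [j H]]]|].
- by exists 0%N, j.+1; rewrite /= Pa Qj ltnS ltj.
- by exists i.+1, j.+1; rewrite /= !ltnS.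
case=> i [j /and4P[]]; case: i j => [|i] [|j] // lt1 lt2 Pi Qj.
  by left; rewrite [P a]Pi; apply/(has_nthP x0); exists j.
by right; apply/IH; exists i, j; apply/and4P.
Qed.

Lemma regular_before P Q : regular (before P Q).
Proof.
exists (bool * bool)%type, (false, false).
exists (fun s a => (s.1 || P a, s.2 || s.1 && Q a)), snd => u.
suff -> : foldl (fun s a => (s.1 || P a, s.2 || s.1 && Q a)) (false, false) u
          = (has P u, before P Q u) by [].
elim/last_ind: u => // u a IH.
by rewrite foldl_rcons IH before_rcons has_rcons orbC.
Qed.

End RegularClosure.

(** The subset construction: the states reached on v are those reached on the
    preimages of v. *)
Lemma regular_proj (A : finType) (B : eqType) (f : A -> B) (L : seq A -> bool) :
  regular L -> exists L', regular L' /\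
    forall v, L' v <-> exists2 u, map f u = v & L u.
Proof.
case=> S [s0 [d [acc H]]].
pose d' (Q : {set S}) b :=
  [set q | [exists q' in Q, exists a, (f a == b) && (d q' a == q)]].
have runP v q : reflect (exists2 u, map f u = v & foldl d s0 u = q)
                        (q \in foldl d' [set s0] v).
  elim/last_ind: v q => [|v b IH] q.
    rewrite inE; apply: (iffP eqP) => [->|[[]] //]; by exists [::].
  rewrite foldl_rcons inE; apply: (iffP exists_inP) => [[q' /IH[u <- <-]]|].
    case/existsP => a /andP[/eqP <- /eqP <-].
    by exists (rcons u a); rewrite ?map_rcons ?foldl_rcons.
  case=> u; case/lastP: u => [|u a]; first by case: v {IH}.
  rewrite map_rcons foldl_rcons => /rcons_inj[Eu Ea] Eq.
  exists (foldl d s0 u); first by apply/IH; exists u.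
  by apply/existsP; exists a; rewrite Ea Eq !eqxx.
exists (fun v => [exists q in foldl d' [set s0] v, acc q]); split.
  by exists {set S}, [set s0], d', (fun Q : {set S} => [exists q in Q, acc q]).
move=> v; split=> [/exists_inP[q /runP[u Eu <-] accq]|[u Eu Lu]].
  by exists u; rewrite ?H.
apply/exists_inP; exists (foldl d s0 u); [by apply/runP; exists u | by rewrite -H].
Qed.

(** * Relations recognised by automata *)

Section Encoding.
Variable Sigma : finType.
Implicit Types V W : finType.

Local Notation letter V W := (Sigma * {set V} * {set W})%type.

(** A word with a valuation of its variables, as a word over a larger alphabet:
    each letter also carries the variables whose value is its position or contains
    its position. *)
Definition enc (V W : finType) (w : seq Sigma) (e : {ffun V -> 'I_(size w)})
    (E : {ffun W -> {set 'I_(size w)}}) : seq (letter V W) :=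
  [seq (tnth (in_tuple w) i, [set v | e v == i], [set x | i \in E x])
     | i <- enum 'I_(size w)].

Lemma size_enc V W w e E : size (@enc V W w e E) = size w.
Proof. by rewrite size_map size_enum_ord. Qed.

Lemma nth_enc V W w e E x0 (i : 'I_(size w)) :
  nth x0 (@enc V W w e E) i =
  (tnth (in_tuple w) i, [set v | e v == i], [set x | i \in E x]).
Proof. by rewrite (nth_map i) ?size_enum_ord // nth_ord_enum. Qed.

Definition reindex_env (V V' : finType) (T : Type) (f : V -> V') (e : {ffun V' -> T})
  : {ffun V -> T} := [ffun v => e (f v)].

Definition reindex_letter (V V' W W' : finType) (f : V -> V') (g : W -> W')
    (l : letter V' W') : letter V W :=
  (l.1.1, f @^-1: l.1.2, g @^-1: l.2).

Lemma enc_reindex (V V' W W' : finType) (f : V -> V') (g : W -> W') w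
    (e : {ffun V' -> 'I_(size w)}) (E : {ffun W' -> {set 'I_(size w)}}) :
  map (reindex_letter f g) (enc e E) = enc (reindex_env f e) (reindex_env g E).
Proof.
rewrite -map_comp; apply: eq_map => i /=; congr (_, _, _);
  by apply/setP => v; rewrite !inE ffunE.
Qed.

(** Each mark is carried by exactly one letter: some letter carries it, and none
    does so after another. *)
Definition valid V W (u : seq (letter V W)) : bool :=
  all (fun v => has (fun l : letter V W => v \in l.1.2) u &&
       ~~ before (fun l : letter V W => v \in l.1.2)
                 (fun l : letter V W => v \in l.1.2) u) (enum V).

Lemma regular_valid V W : regular (@valid V W).
Proof.
apply: regular_all => v; apply: regular_and; first exact: regular_has.
by apply: regular_not; apply: regular_before.
Qed.

Lemma valid_enc V W w e E : valid (@enc V W w e E).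
Proof.
apply/allP => v _; apply/andP; split.
  by apply/hasP; exists (nth (tnth (in_tuple w) (e v), set0, set0) (enc e E) (e v));
    [rewrite mem_nth ?size_enc | rewrite nth_enc inE /=].
apply/(beforeP _ _ (tnth (in_tuple w) (e v), set0, set0)) => -[i [j]].
rewrite size_enc => /and4P[ltij ltj].
have lti := ltn_trans ltij ltj.
rewrite (nth_enc _ _ _ (Ordinal lti)) (nth_enc _ _ _ (Ordinal ltj)) !inE /=.
by move=> /eqP -> /eqP[] E2; rewrite E2 ltnn in ltij.
Qed.

(** A correctly marked word over the encoding of e and E encodes an extension of
    e and E. This is what makes projection implement quantification. *)
Lemma decode (V V' W W' : finType) (f : V -> V') (g : W -> W') w
    (e : {ffun V -> 'I_(size w)}) (E : {ffun W -> {set 'I_(size w)}})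
    (u : seq (letter V' W')) :
  map (reindex_letter f g) u = enc e E -> valid u ->
  exists e' E', [/\ u = @enc V' W' w e' E', reindex_env f e' = e & reindex_env g E' = E].
Proof.
move=> Eu vu.
have su : size u = size w by rewrite -(size_map (reindex_letter f g)) Eu size_enc.
(* over the empty word there are no position variables, and no default letter *)
case: (posnP (size w)) => [w0 | w_gt0].
  have noV (T : finType) (h : {ffun T -> 'I_(size w)}) : T -> False.
    by move=> x; case: (h x) => i; rewrite w0.
  have nV' : V' -> False.
    move=> v; move/allP: vu => /(_ v (mem_enum _ v))/andP[].
    by move/eqP: su; rewrite w0 size_eq0 => /eqP ->.
  exists [ffun v => False_rect _ (nV' v)].
  exists [ffun => set0]; split.
  - by rewrite (size0nil (etrans su w0)); apply/esym/size0nil; rewrite size_enc.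
  - by apply/ffunP => v; case: (noV _ e v).
  apply/ffunP => x; apply/setP => i; case: (i) => m H.
  by exfalso; rewrite w0 in H.
pose l0 : letter V' W' := (tnth (in_tuple w) (Ordinal w_gt0), set0, set0).
have uniq_mark (v : V') : exists i : 'I_(size w), forall j : 'I_(size w),
    (v \in (nth l0 u j).1.2) = (i == j).
  move/allP: vu => /(_ v (mem_enum _ v))/andP[/(has_nthP l0)[i lti vi] nb].
  have lti' : (i < size w)%N by rewrite -su.
  exists (Ordinal lti') => j; apply/idP/eqP => [vj|<-]; last exact: vi.
  apply: val_inj => /=; have ltj : (j < size u)%N by rewrite su.
  case: (ltngtP i j) => // lt; case/negP: nb; apply/(beforeP _ _ l0).
    by exists i, (val j); apply/and4P.
  by exists (val j), i; apply/and4P.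
have [h hP] := fin_all_exists uniq_mark.
have nthu (i : 'I_(size w)) :
    reindex_letter f g (nth l0 u i) =
    (tnth (in_tuple w) i, [set v | e v == i], [set x | i \in E x]).
  by rewrite -(nth_enc e E (reindex_letter f g l0)) -Eu (nth_map l0) ?su.
exists [ffun v => h v], [ffun x => [set i : 'I_(size w) | x \in (nth l0 u i).2]].
split.
- apply: (@eq_from_nth _ l0) => [|i]; first by rewrite size_enc.
  rewrite su => lti; rewrite (nth_enc _ _ _ (Ordinal lti)).
  have := nthu (Ordinal lti); case E1 : (nth l0 u _) => [[a S] X] [-> _ _].
  congr (_, _, _); apply/setP => v; rewrite !inE ffunE.
    by have := hP v (Ordinal lti); rewrite E1.
  by rewrite inE E1.
- apply/ffunP => v; rewrite !ffunE; have [_ /setP/(_ v) H _] := nthu (h (f v)).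
  by move: H; rewrite !inE hP eqxx => /esym/eqP ->.
apply/ffunP => x; apply/setP => i; rewrite !ffunE inE.
by have [_ _ /setP/(_ x)] := nthu i; rewrite !inE.
Qed.

Local Notation relation V W := (forall w : seq Sigma,
  {ffun V -> 'I_(size w)} -> {ffun W -> {set 'I_(size w)}} -> bool).

Definition definable V W (R : relation V W) : Prop :=
  exists L, regular L /\ forall w e E, R w e E = L (enc e E).

Section DefinableBool.
Variables V W : finType.
Implicit Types R : relation V W.

Lemma definable_ext R R' :
  (forall w e E, R w e E = R' w e E) -> definable R -> definable R'.
Proof. by move=> ER [L [rL H]]; exists L; split=> // w e E; rewrite -ER H. Qed.

Lemma definable_not R : definable R -> definable (fun w e E => ~~ R w e E).
Proof.
case=> L [rL H]; exists (fun u => ~~ L u).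
by split=> [|w e E]; [apply: regular_not | rewrite H].
Qed.

Lemma definable_and R R' : definable R -> definable R' ->
  definable (fun w e E => R w e E && R' w e E).
Proof.
case=> L [rL H] [L' [rL' H']]; exists (fun u => L u && L' u).
by split=> [|w e E]; [apply: regular_and | rewrite H H'].
Qed.

Lemma definable_or R R' : definable R -> definable R' ->
  definable (fun w e E => R w e E || R' w e E).
Proof.
move=> dR dR'; have dN := definable_and (definable_not dR) (definable_not dR').
by apply: definable_ext (definable_not dN) => w e E; rewrite negb_and !negbK.
Qed.

Lemma definable_exists_fin (T : finType) (R : T -> relation V W) :
  (forall c, definable (R c)) -> definable (fun w e E => [exists c, R c w e E]).
Proof.
move=> dR; have dh (s : seq T) : definable (fun w e E => has (fun c => R c w e E) s).
  elim: s => [|c s IH] /=; last exact: definable_or.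
  by exists (fun _ => ~~ true); split=> //; apply/regular_not/regular_true.
apply: definable_ext (dh (enum T)) => w e E.
by apply/hasP/existsP => [[c _ H]|[c H]]; exists c => //; rewrite mem_enum.
Qed.

Lemma definable_has (P : pred (letter V W)) :
  definable (fun w e E => has P (enc e E)).
Proof. by exists (has P); split=> //; apply: regular_has. Qed.

End DefinableBool.

Section DefinableReindex.
Variables (V V' W W' : finType) (f : V -> V') (g : W -> W').

Lemma definable_reindex (R : relation V W) :
  definable R ->
  definable (fun w (e : {ffun V' -> 'I_(size w)}) E =>
               R w (reindex_env f e) (reindex_env g E)).
Proof.
case=> L [rL H]; exists (fun u => L (map (reindex_letter f g) u)).
by split=> [|w e E]; [apply: regular_preim | rewrite H enc_reindex].
Qed.

(** Quantifies over all the variables outside the images of f and g at once: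
    erasing their marks is a projection of the language of correctly marked words. *)
Lemma definable_exists (R' : relation V' W') (R : relation V W) :
  definable R' ->
  (forall w e E, R w e E <-> exists e' E',
     [/\ reindex_env f e' = e, reindex_env g E' = E & R' w e' E']) ->
  definable R.
Proof.
case=> L [rL H] HR.
have [L' [rL' HL']] := regular_proj (reindex_letter f g)
                         (regular_and (@regular_valid V' W') rL).
exists L'; split=> // w e E; apply/idP/idP.
  case/HR => e' [E' [<- <- HR']]; apply/HL'; exists (enc e' E').
    exact: enc_reindex.
  by rewrite valid_enc -H.
case/HL' => u Eu /andP[vu Lu]; apply/HR.
have [e' [E' [Ee ? ?]]] := decode Eu vu.
by exists e', E'; split=> //; rewrite H -Ee.
Qed.

End DefinableReindex.

Lemma definable_lt (V W : finType) (x y : V) :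
  definable (fun w (e : {ffun V -> 'I_(size w)}) (E : {ffun W -> {set 'I_(size w)}}) =>
    (e x < e y)%N).
Proof.
exists (before (fun l : letter V W => x \in l.1.2) (fun l : letter V W => y \in l.1.2)).
split=> [|w e E]; first exact: regular_before.
pose l0 : letter V W := (tnth (in_tuple w) (e x), set0, set0).
apply/idP/(beforeP _ _ l0) => [lt|[i [j]]].
  by exists (e x), (e y); rewrite lt size_enc ltn_ord !nth_enc !inE /= !eqxx.
rewrite size_enc => /and4P[ltij ltj].
rewrite (nth_enc _ _ _ (Ordinal (ltn_trans ltij ltj))) (nth_enc _ _ _ (Ordinal ltj)).
by rewrite !inE /= => /eqP -> /eqP ->.
Qed.

(** As x marks exactly one letter, a property of the letter at x is the existence
    of a letter that is marked by x and has the property. *)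
Lemma definable_at (V W : finType) (x : V) (P : pred (letter V W)) :
  definable (fun w (e : {ffun V -> 'I_(size w)}) (E : {ffun W -> {set 'I_(size w)}}) =>
    P (tnth (in_tuple w) (e x), [set v | e v == e x], [set X | e x \in E X])).
Proof.
apply: definable_ext (definable_has (fun l => (x \in l.1.2) && P l)) => w e E.
rewrite has_map; apply/hasP/idP => [[i _ /=]|H].
  by rewrite inE => /andP[/eqP <-].
by exists (e x); rewrite ?mem_enum //= inE eqxx.
Qed.

(** Each connective is a closure property of definable relations; universal
    quantifiers are dual to existential ones. *)
Lemma definable_mso k m (phi : mso Sigma k m) :
  definable (fun w (e : {ffun 'I_k -> 'I_(size w)})
                   (E : {ffun 'I_m -> {set 'I_(size w)}}) =>
    msat w phi [tuple e i | i < k] [tuple E j | j < m]).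
Proof.
(* the new variable of a quantifier is variable 0, the others are lifted *)
have consE (T : Type) n x (t : n.-tuple T) (h : {ffun 'I_n.+1 -> T}) :
    h ord0 = x -> [tuple reindex_env (lift ord0) h i | i < n] = t ->
    [tuple of x :: t] = [tuple h i | i < n.+1].
  move=> <- <-; apply: eq_from_tnth => i.
  by case: (unliftP ord0 i) => [j|] ->; rewrite ?tnthS ?tnth0 !tnth_mktuple ?ffunE.
have reid (I T : finType) (h : {ffun I -> T}) : reindex_env id h = h.
  by apply/ffunP => i; rewrite ffunE.
pose ext (T : Type) n (x : T) (h : {ffun 'I_n -> T}) : {ffun 'I_n.+1 -> T} :=
  [ffun i => if unlift ord0 i is Some j then h j else x].
have ext0 T n (x : T) (h : {ffun 'I_n -> T}) : ext T n x h ord0 = x.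
  by rewrite ffunE unlift_none.
have extK T n (x : T) (h : {ffun 'I_n -> T}) : reindex_env (lift ord0) (ext T n x h) = h.
  by apply/ffunP => i; rewrite !ffunE liftK.
pose tuple_definable k m (Q : forall w : seq Sigma, k.-tuple 'I_(size w) ->
    m.-tuple {set 'I_(size w)} -> bool) :=
  definable (fun w (e : {ffun 'I_k -> 'I_(size w)})
                   (E : {ffun 'I_m -> {set 'I_(size w)}}) =>
    Q w [tuple e i | i < k] [tuple E j | j < m]).
have exPos l n Q : tuple_definable l.+1 n Q ->
    tuple_definable l n (fun w e E => [exists i, Q w [tuple of i :: e] E]).
  move=> dQ; apply: (definable_exists (f := lift ord0) (g := id) dQ).
  move=> w e E /=; split=> [/existsP[i Hi]|[e' [E' [<- <- H]]]].
    exists (ext _ _ i e), E; split; [exact: extK | exact: reid|].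
    by rewrite -(consE _ _ _ _ _ (ext0 _ _ _ _) erefl) extK.
  by apply/existsP; exists (e' ord0); rewrite reid (consE _ _ _ _ e').
have exSet l n Q : tuple_definable l n.+1 Q ->
    tuple_definable l n (fun w e E => [exists A, Q w e [tuple of A :: E]]).
  move=> dQ; apply: (definable_exists (f := id) (g := lift ord0) dQ).
  move=> w e E /=; split=> [/existsP[i Hi]|[e' [E' [<- <- H]]]].
    exists e, (ext _ _ i E); split; [exact: reid | exact: extK|].
    by rewrite -(consE _ _ _ _ _ (ext0 _ _ _ _) erefl) extK.
  by apply/existsP; exists (E' ord0); rewrite reid (consE _ _ _ _ E').
elim: phi => {k m}.
- move=> k m x y; apply: definable_ext (definable_lt _ x y) => w e E.
  by rewrite /= !tnth_mktuple.
- move=> k m x y; apply: definable_ext (definable_at x (fun l => y \in l.1.2)).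
  by move=> w e E; rewrite /= !tnth_mktuple inE eq_sym.
- move=> k m a x; apply: definable_ext (definable_at x (fun l => l.1.1 == a)).
  by move=> w e E; rewrite /= !tnth_mktuple.
- move=> k m x X; apply: definable_ext (definable_at x (fun l => X \in l.2)).
  by move=> w e E; rewrite /= !tnth_mktuple inE.
- by move=> k m p IH; apply: definable_not.
- by move=> k m p IHp q IHq; apply: definable_and.
- by move=> k m p IHp q IHq; apply: definable_or.
- by move=> k m p; apply: (exPos _ _ (fun w => msat w p)).
- move=> k m p /definable_not/(exPos _ _ (fun w e E => ~~ msat w p e E)).
  by move/definable_not; apply: definable_ext => w e E; rewrite -negb_forall negbK.
- by move=> k m p; apply: (exSet _ _ (fun w => msat w p)).
- move=> k m p /definable_not/(exSet _ _ (fun w e E => ~~ msat w p e E)).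
  by move/definable_not; apply: definable_ext => w e E; rewrite -negb_forall negbK.
Qed.

End Encoding.

(** * The last letter but one of a polyregular output *)

Section Penultimate.
Variables (Sigma Gamma : finType) (p : presentation Sigma Gamma).
Implicit Types (w : seq Sigma) (g : Gamma).

(** In the output order, b is the greatest atom and a, labelled g, comes right
    before it. *)
Definition penultimate g w (a b : atom p w) : bool :=
  [&& selected a, selected b, has_label a g, chi a b &
      ~~ [exists c : atom p w, selected c && (chi b c || chi a c && chi c b)]].

Definition penultimate_label g w : bool :=
  [exists a : atom p w, exists b : atom p w, penultimate g a b].

(** Since labels exist and are unique, the last two letters of the output are the
    labels of the last two atoms of the sorted list, and these are the atoms
    found by [penultimate]. *)
Lemma penultimate_labelE g w s x y :
  output (@chi _ _ p w) = rcons (rcons s x) y -> penultimate_label g w = (x == g).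
Proof.
have [irr tr tot] := chi_linear p w.
rewrite /output; set lab := (fun a : atom p w => _); set le := (fun a b : atom p w => _).
set S := sort _ _ => outE.
have memS (a : atom p w) : (a \in S) = selected a by rewrite mem_sort mem_enum.
have uS : uniq S by rewrite sort_uniq enum_uniq.
have allS : all (@selected _ _ p w) S by apply/allP => a; rewrite memS.
have pwS : pairwise le S.
  rewrite -(@sorted_pairwise_in _ (@selected _ _ p w)) //; last first.
    move=> b a c sb sa sc /orP[/eqP -> //|ab] /orP[/eqP <-|bc]; rewrite /le.
      by rewrite ab orbT.
    by rewrite (tr _ _ _ sb sa sc ab bc) orbT.
  apply: (@sort_sorted_in _ (@selected _ _ p w)).
    move=> a b sa sb; rewrite /le (eq_sym b a); case: eqVneq => //= ab.
    exact: tot.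
  by apply/allP => a; rewrite mem_enum.
have labS : map lab S = map Some (rcons (rcons s x) y).
  rewrite -outE pmapS_filter; congr map; apply/esym/all_filterP/allP => a.
  rewrite memS => sa; have [g' [lg' _]] := label_unique sa.
  by rewrite /lab /=; case: pickP => // /(_ g'); rewrite lg'.
case/lastP: S labS memS uS allS pwS {outE} => [|S b]; first by case: s => [|? []].
rewrite !map_rcons => /rcons_inj[] + _.
case/lastP: S => [|S a]; first by case: s.
rewrite map_rcons => /rcons_inj[_ laba] memS uS allS.
rewrite -!cats1 !pairwise_cat !allrel1r /= !andbT => /andP[leb /andP[lea _]].
have xlab : has_label a x.
  by move: laba; rewrite /lab; case: pickP => // g' lg' [<-].
have sa : selected a by rewrite -memS mem_rcons inE mem_rcons inE eqxx orbT.
have sb : selected b by rewrite -memS mem_rcons inE eqxx.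
have labE g' : has_label a g' = (x == g').
  apply/idP/eqP => [lg|<- //]; have [g0 [_ ug]] := label_unique sa.
  by rewrite -(ug x xlab) (ug g' lg).
have asym (c c' : atom p w) : selected c -> selected c' -> chi c c' -> chi c' c -> False.
  by move=> sc sc' cc' c'c; have := irr c sc; rewrite (tr _ _ _ sc' sc sc cc' c'c).
move: uS; rewrite !rcons_uniq mem_rcons inE negb_or => /andP[/andP[nba nbS] /andP[naS _]].
have chib (c : atom p w) : selected c -> c != b -> chi c b.
  move=> sc ncb; move: leb; rewrite all_cat /= andbT => /andP[/allP lebS leab].
  move: sc; rewrite -memS !mem_rcons !inE (negbTE ncb) /= mem_rcons inE.
  case/orP=> [/eqP ->|/lebS]; last by rewrite /le (negbTE ncb).
  by move: leab; rewrite /le eq_sym (negbTE nba).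
have chia (c : atom p w) : selected c -> c != b -> c != a -> chi c a.
  move=> sc ncb nca; move: sc; rewrite -memS !mem_rcons !inE (negbTE ncb) /=.
  by rewrite mem_rcons inE (negbTE nca) => /(allP lea); rewrite /le (negbTE nca).
rewrite -labE; apply/existsP/idP => [[a' /existsP[b' ]]|la].
  case/and5P=> sa' sb' la' chab' /existsP nex.
  have Eb : b' = b.
    case: (eqVneq b' b) => // nb; case: nex; exists b.
    by rewrite sb chib.
  move: chab' nex {sb'}; rewrite {b'}Eb => chab' nex.
  have nab : a' != b by apply/eqP => E; move: chab'; rewrite E irr.
  case: (eqVneq a' a) la' => [-> //|na] _; case: nex; exists a.
  by rewrite sa (chia a') // (chib a) ?orbT // eq_sym.
exists a; apply/existsP; exists b; rewrite /penultimate sa sb la chib 1?eq_sym //=.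
apply/existsP => -[c /andP[sc /orP[bc|/andP[ac cb]]]].
  have ncb : c != b by apply/eqP => E; move: bc; rewrite E irr.
  exact: asym sb sc bc (chib _ sc ncb).
have ncb : c != b by apply/eqP => E; move: cb; rewrite E irr.
have nca : c != a by apply/eqP => E; move: ac; rewrite E irr.
exact: asym sa sc ac (chia _ sc ncb nca).
Qed.

Definition tuple_env (V : finType) k w (e : {ffun V -> 'I_(size w)}) (h : 'I_k -> V) :
  k.-tuple 'I_(size w) := [tuple e (h i) | i < k].

(** An atom variable of copy name c is represented by [arity c] position
    variables, here named by h. *)
Definition atom_at (V : finType) w (e : {ffun V -> 'I_(size w)}) c
  (h : 'I_(arity c) -> V) : atom p w := existT _ c (tuple_env e h).

Lemma definable_models (V : finType) k (phi : mso Sigma k 0) (h : 'I_k -> V) :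
  definable (fun w (e : {ffun V -> 'I_(size w)})
      (E : {ffun 'I_0 -> {set 'I_(size w)}}) => models w phi (tuple_env e h)).
Proof.
apply: definable_ext (definable_reindex h id (definable_mso phi)) => w e E.
rewrite /models; congr (msat w phi _ _); last exact: tuple0.
by apply: eq_mktuple => i; rewrite ffunE.
Qed.

Lemma definable_selected (V : finType) c (h : 'I_(arity c) -> V) :
  definable (fun w (e : {ffun V -> 'I_(size w)})
      (E : {ffun 'I_0 -> {set 'I_(size w)}}) => selected (atom_at e h)).
Proof. exact: (definable_models (sel_formula c) h). Qed.

Lemma definable_label (V : finType) c (h : 'I_(arity c) -> V) g :
  definable (fun w (e : {ffun V -> 'I_(size w)})
      (E : {ffun 'I_0 -> {set 'I_(size w)}}) => has_label (atom_at e h) g).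
Proof. exact: (definable_models (label_formula c g) h). Qed.

Lemma definable_chi (V : finType) c c' (h : 'I_(arity c) -> V) (h' : 'I_(arity c') -> V) :
  definable (fun w (e : {ffun V -> 'I_(size w)})
      (E : {ffun 'I_0 -> {set 'I_(size w)}}) => chi (atom_at e h) (atom_at e h')).
Proof.
pose hh i := match split i with inl j => h j | inr j => h' j end.
apply: definable_ext (definable_models (order_formula c c') hh) => w e E.
rewrite /chi /=; congr (models w _ _); apply: eq_from_tnth => i.
rewrite tnth_mktuple /hh -[i in RHS](splitK i); case: (split i) => j.
  by rewrite /= tnth_lshift tnth_mktuple.
by rewrite /= tnth_rshift tnth_mktuple.
Qed.

(** An atom is a copy name, from a finite set, with a tuple of positions; the sum
    type adds its positions as fresh variables to those in V. *)
Lemma definable_exists_atom (V : finType)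
    (Q : forall w, atom p w -> {ffun V -> 'I_(size w)} ->
                   {ffun 'I_0 -> {set 'I_(size w)}} -> bool) :
  (forall c, definable (fun w (e : {ffun V + 'I_(arity c) -> 'I_(size w)}) E =>
      Q w (atom_at e inr) (reindex_env inl e) E)) ->
  definable (fun w e E => [exists a, Q w a e E]).
Proof.
move=> dQ.
have d1 c : definable (fun w (e : {ffun V -> 'I_(size w)}) E =>
    [exists t : (arity c).-tuple 'I_(size w), Q w (existT _ c t) e E]).
  apply: (definable_exists (f := inl) (g := id) (dQ c)) => w e E.
  have reid (h : {ffun 'I_0 -> {set 'I_(size w)}}) : reindex_env id h = h.
    by apply/ffunP => i; rewrite ffunE.
  split=> [/existsP[t Ht]|[e' [E' [<- <- H]]]]; last first.
    by apply/existsP; exists (tuple_env e' inr); rewrite reid.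
  pose e' : {ffun V + 'I_(arity c) -> 'I_(size w)} :=
    [ffun v => match v with inl v => e v | inr i => tnth t i end].
  have Ee : reindex_env inl e' = e by apply/ffunP => v; rewrite !ffunE.
  exists e', E; split=> //; rewrite Ee /atom_at.
  have -> // : tuple_env e' inr = t.
  by apply: eq_from_tnth => i; rewrite tnth_mktuple ffunE.
apply: definable_ext (definable_exists_fin d1) => w e E.
apply/existsP/existsP => [[c /existsP[t H]]|[[c t] H]]; first by exists (existT _ c t).
by exists c; apply/existsP; exists t.
Qed.

Lemma atom_at_reindex (V V' : finType) (f : V -> V') w (e : {ffun V' -> 'I_(size w)})
    c (h : 'I_(arity c) -> V) :
  atom_at (reindex_env f e) h = atom_at e (f \o h).
Proof. by congr existT; apply: eq_mktuple => i; rewrite ffunE. Qed.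

Lemma definable_penultimate g :
  definable (fun w (e : {ffun void -> 'I_(size w)})
      (E : {ffun 'I_0 -> {set 'I_(size w)}}) => penultimate_label g w).
Proof.
apply: (definable_exists_atom (Q := fun w a e E =>
          [exists b : atom p w, penultimate g a b])) => c1.
apply: (definable_exists_atom (Q := fun w b e E => penultimate g (atom_at e inr) b)) => c2.
apply: (definable_ext (R := fun w
      (e : {ffun void + 'I_(arity c1) + 'I_(arity c2) -> 'I_(size w)})
      (E : {ffun 'I_0 -> {set 'I_(size w)}}) =>
   penultimate g (atom_at e (inl \o inr)) (atom_at e inr))).
  by move=> w e E; rewrite atom_at_reindex.
apply: definable_and; first exact: definable_selected.
apply: definable_and; first exact: definable_selected.
apply: definable_and; first exact: definable_label.
apply: definable_and; first exact: definable_chi.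
apply: definable_not.
apply: (definable_exists_atom (Q := fun w c e E =>
   selected c && (chi (atom_at e inr) c ||
                  chi (atom_at e (inl \o inr)) c && chi c (atom_at e inr)))) => c3.
apply: (definable_ext (R := fun w
   (e : {ffun void + 'I_(arity c1) + 'I_(arity c2) + 'I_(arity c3) -> 'I_(size w)})
   (E : {ffun 'I_0 -> {set 'I_(size w)}}) =>
   selected (atom_at e inr) && (chi (atom_at e (inl \o inr)) (atom_at e inr) ||
     chi (atom_at e (inl \o (inl \o inr))) (atom_at e inr) &&
     chi (atom_at e inr) (atom_at e (inl \o inr))))).
  by move=> w e E; rewrite !atom_at_reindex.
apply: definable_and; first exact: definable_selected.
apply: definable_or; first exact: definable_chi.
by apply: definable_and; exact: definable_chi.
Qed.

Lemma regular_penultimate g : regular (penultimate_label g).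
Proof.
have [L [rL HL]] := definable_penultimate g.
have := regular_preim (fun x : Sigma => (x, set0 : {set void}, set0 : {set 'I_0})) rL.
apply: regular_ext => w.
pose e : {ffun void -> 'I_(size w)} := [ffun v : void => match v with end].
rewrite (HL w e [ffun => set0]) /enc; congr L.
have Ew : [seq tnth (in_tuple w) i | i <- enum 'I_(size w)] = w.
  exact: map_tnth_enum.
rewrite -[X in map _ X = _]Ew -map_comp.
by apply: eq_map => i /=; congr (_, _, _); apply/setP => -[].
Qed.

End Penultimate.

(** * Two mountains *)

Lemma rise_nseqU a : rise (nseq a U) = a%:Z.
Proof. by rewrite /rise !count_nseq /= mul1n mul0n subr0. Qed.

Lemma rise_nseqD a : rise (nseq a D) = - a%:Z.
Proof. by rewrite /rise !count_nseq /= mul1n mul0n sub0r. Qed.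

Lemma level_nseqU (h a j : nat) :
  level h (nseq a U) j = nseq ((h <= j) && (j < h + a))%N U.
Proof.
elim: a h => [|a IH] h /=; first by rewrite addn0; case: (leqP h j).
have -> : h%:Z + 1 = h.+1 by rewrite intS addrC.
by rewrite IH eqz_nat; case: (ltngtP h j) => [||->]; rewrite ?addSnnS ?leq_addr //=;
  rewrite ?ltnn ?addnS ?ltnS ?leq_addr.
Qed.

Lemma level_nseqD (h a j : nat) : (a <= h)%N ->
  level h (nseq a D) j = nseq ((h < j + a) && (j <= h))%N D.
Proof.
elim: a h => [|a IH] h leah /=; first by rewrite addn0; case: (leqP j h).
case: h leah => // h leah.
have -> : h.+1%:Z + -1 = h by rewrite intS addrAC subrr add0r.
rewrite IH // eqz_nat.
have [<-|neq] := eqVneq h.+1 j; last by congr (nseq (nat_of_bool _) _); lia.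
by rewrite ltnn andbF leqnn andbT addnS ltnS leq_addr.
Qed.

(** Semilengths b and a + 1; the D and U in the middle of the second mountain cut
    a notch of depth 1 into its top, so that the path starts a step D twice at
    height a there. *)
Definition two_mountains (b a : nat) : seq step :=
  (nseq b U ++ nseq b D) ++ nseq a U ++ [:: D; U] ++ nseq a D.

Lemma height_ge w k : - (count_mem D w)%:Z <= height w k.
Proof.
have aux (i j l : nat) : (i <= j)%N -> - j%:Z <= l%:Z - i%:Z by lia.
exact/aux/leq_count_subseq/take_subseq.
Qed.

Lemma height_cat_ge0 (h : int) u v :
  (forall k, 0 <= h + height u k) -> (forall k, 0 <= h + rise u + height v k) ->
  forall k, 0 <= h + height (u ++ v) k.
Proof.
move=> nnu nnv k; rewrite heightE take_cat; case: ltnP => _; first exact: nnu.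
by rewrite rise_cat addrA; apply: nnv.
Qed.

Lemma dyck_two_mountains b a : (0 < a)%N -> two_mountains b a \in dyck (b + a.+1).
Proof.
move=> a_gt0; apply/dyckP; split.
- have nn (h : int) w : (count_mem D w)%:Z <= h -> forall k, 0 <= h + height w k.
    by move=> le k; have := height_ge w k; lia.
  move=> k; rewrite -[height _ _]add0r /two_mountains -!catA.
  do 4?[apply: height_cat_ge0]; apply: nn; rewrite ?count_nseq /=;
    rewrite ?rise_nseqU ?rise_nseqD /rise /=; lia.
- by rewrite /two_mountains !rise_cat !rise_nseqU !rise_nseqD /rise /=; lia.
by rewrite /two_mountains !size_cat !size_nseq /=; lia.
Qed.

Lemma level_two_mountains b a (j : nat) : (0 < a)%N ->
  level 0 (two_mountains b a) j =
  nseq (j < b)%N U ++ nseq (0 < j <= b)%N D ++ nseq (j < a)%N U ++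
  nseq (j == a) D ++ nseq (j == a.-1) U ++ nseq (0 < j <= a)%N D.
Proof.
case: a => // a _; rewrite /two_mountains !level_cat !rise_cat !rise_nseqU !rise_nseqD.
rewrite !add0r subrr !add0r [rise [:: D; U]]subrr addr0.
rewrite (level_nseqU 0) (level_nseqU 0) !level_nseqD // -catA.
have -> : level a.+1 [:: D; U] j = nseq (j == a.+1) D ++ nseq (j == a) U.
  rewrite /= -[X in X == j%:Z]/(a.+1%:Z) eqz_nat eq_sym.
  have -> : a.+1%:Z + -1 = a by rewrite intS addrAC subrr add0r.
  by rewrite eqz_nat (eq_sym a); case: (j == a.+1); case: (j == a).
rewrite -catA; congr (nseq _ _ ++ nseq _ _ ++ nseq _ _ ++ _ ++ _ ++ nseq _ _);
  congr nat_of_bool; lia.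
Qed.

(** Levels are listed by increasing height, and empty ones contribute nothing. *)
Lemma sweep_top n P m : P \in dyck n -> (m.+1 < n.*2)%N ->
  (forall j, (m.+1 < j)%N -> level 0 P j = [::]) ->
  exists t, height_sweep P = t ++ rev (level 0 P m) ++ rev (level 0 P m.+1).
Proof.
move=> dP ltm top; rewrite (sweep_blocks dP).
exists (flatten [seq rev (level 0 P j) | j <- iota 0 m]).
have -> : n.*2 = (m + (n.*2 - m.+2).+2)%N by lia.
rewrite iotaD map_cat flatten_cat /=; congr (_ ++ _ ++ _).
set l := iota _ _; have : all (fun j => m.+1 < j)%N l.
  by apply/allP => j; rewrite mem_iota; lia.
elim: l => [|j l IH] /=; first by rewrite cats0.
by case/andP=> ltj /IH; rewrite (top j ltj).
Qed.

Lemma level_two_mountains_above b a j : (0 < a <= b)%N -> (b < j)%N ->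
  level 0 (two_mountains b a) j = [::].
Proof.
move=> /andP[a_gt0 leab] ltbj; rewrite level_two_mountains //.
have [-> ->] : (j < b)%N = false /\ (0 < j <= b)%N = false by lia.
have [-> ->] : (j < a)%N = false /\ (0 < j <= a)%N = false by lia.
by have [-> ->] : (j == a) = false /\ (j == a.-1) = false by lia.
Qed.

(** Level a is DDD, one D from the first mountain and two from the second. *)
Lemma height_sweep_equal_mountains a : (0 < a)%N ->
  exists s, height_sweep (two_mountains a a) = rcons (rcons s D) D.
Proof.
case: a => // a _; have dP := @dyck_two_mountains a.+1 a.+1 isT.
have [| |t ->] := sweep_top (m := a) dP; first by lia.
  by move=> j; apply: level_two_mountains_above; rewrite ltn0Sn leqnn.
move: (level 0 _ a) => l; exists (t ++ rev l ++ [:: D]).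
rewrite level_two_mountains // ltnn eqxx leqnn /= (gtn_eqF (ltnSn a)).
by rewrite -!cats1 -!catA.
Qed.

(** Level b is the single last D of the output. Before it comes the first letter
    of level b - 1, the U of the ascent of the first mountain. *)
Lemma height_sweep_higher_mountain a b : (0 < a < b)%N ->
  exists s, height_sweep (two_mountains b a) = rcons (rcons s U) D.
Proof.
case: b => [|b]; first by rewrite ltn0 andbF.
case/andP=> a_gt0 ltab; have dP := @dyck_two_mountains b.+1 a a_gt0.
have [| |t ->] := sweep_top (m := b) dP; first by lia.
  by move=> j; apply: level_two_mountains_above; rewrite a_gt0 ltnW.
rewrite !level_two_mountains // ltnSn ltnn ?leqnn /=.
have [-> ->] : (b.+1 < a)%N = false /\ (b.+1 <= a)%N = false by lia.
have [-> ->] : (b.+1 == a) = false /\ (b.+1 == a.-1) = false by lia.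
set r := (X in rev (_ :: X)); exists (t ++ rev r).
by rewrite rev_cons -!cats1 -!catA.
Qed.

(** Two first mountains that lead the automaton to the same state are
    exchangeable in front of the notched mountain of the lower height. *)
Lemma not_polyregular_height_sweep (T : partial_map step step) :
  (forall n P, P \in dyck n -> T P = Some (height_sweep P)) -> ~ polyregular T.
Proof.
move=> TE [p pE].
have outE n P : P \in dyck n -> output (@chi _ _ p P) = height_sweep P.
  by move=> /TE; rewrite pE /polyregular_map; case: ifP => // _ [].
have [S [s0 [d [acc accE]]]] := regular_penultimate p U.
pose state (i : 'I_(#|S|.+1)) := foldl d s0 (nseq i.+1 U ++ nseq i.+1 D).
have : ~~ injectiveb state.
  by apply/injectiveP => /leq_card; rewrite card_ord ltnn.
case/injectivePn => i [j]; wlog lt : i j / (i < j)%N => [Hwlog ne E|_ E].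
  have [lt|lt|/val_inj Eij] := ltngtP i j; first exact: (Hwlog i j).
    by apply: (Hwlog j i) => //; rewrite eq_sym.
  by rewrite Eij eqxx in ne.
have labelE (k : 'I_(#|S|.+1)) : penultimate_label p U (two_mountains k.+1 i.+1) =
    acc (foldl d (state k) (nseq i.+1 U ++ [:: D; U] ++ nseq i.+1 D)).
  by rewrite accE foldl_cat.
have := labelE j; rewrite -E -labelE.
have [s sE] := @height_sweep_equal_mountains i.+1 isT.
have [t tE] := @height_sweep_higher_mountain i.+1 j.+1 lt.
rewrite (penultimate_labelE U (etrans (outE _ _ (dyck_two_mountains _ _)) sE)) //.
by rewrite (penultimate_labelE U (etrans (outE _ _ (dyck_two_mountains _ _)) tE)).
Qed.

Theorem theorem1p2 :
  [/\ (forall (Sigma Gamma : finType) (f : partial_map Sigma Gamma),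
         sRR1 f -> WRP f),
      sRR1 (fun w : seq step => Some (height_sweep w)),
      (forall n : nat,
         [/\ {in dyck n, forall P, height_sweep P \in dyck n},
             {in dyck n &, injective height_sweep},
             {in dyck n, forall Q, exists2 P, P \in dyck n & height_sweep P = Q} &
             {in dyck n, forall P,
                double_rises (height_sweep P) = valleys P /\
                valleys (height_sweep P) = double_rises P}]),
      (forall n : nat,
         let q : {poly {poly int}} := 'X%:P in
         let t : {poly {poly int}} := 'X in
         \sum_(P : (n.*2).-tuple step | tval P \in dyck n)
            q ^+ valleys P * t ^+ double_rises P =
         \sum_(P : (n.*2).-tuple step | tval P \in dyck n)
            q ^+ double_rises P * t ^+ valleys P) &
      ~ (exists T : partial_map step step,
           polyregular T /\
           forall (n : nat) (P : seq step),
             P \in dyck n -> T P = Some (height_sweep P))].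
Proof.
split.
- exact: sRR1_WRP.
- exact: sweep_sRR1.
- move=> n; split; [exact: sweep_dyck | exact: sweep_inj | exact: sweep_surj | ].
  exact: sweep_stats.
- by move=> n q t; apply: narayana_symmetry.
by case=> T [polyT TE]; apply: (not_polyregular_height_sweep TE).
Qed.
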